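(* Every normal function $f:\mathsf{On}\to\mathsf{On}$ has a unique hyperation $\mathrm{Hyp}[f]=\langle f^\xi\rangle_{\xi\in\mathsf{On}}$, and it is given by the following recursion: 1. $f^0\xi=\xi$ for all $\xi$; 2. $f^1=f$; 3. $f^{\omega^\rho+\xi}=f^{\omega^\rho}\circ f^{\xi}$ whenever $0<\xi<\omega^\rho+\xi$; 4. $f^{\omega^\rho}(0)=\lim_{\zeta\to\omega^\rho}f^\zeta(0)$ for $\rho>0$; 5. $f^{\omega^\rho}(\xi+1)=\lim_{\zeta\to\omega^\rho}f^{\zeta}\bigl(f^{\omega^\rho}(\xi)+1\bigr)$ for $\rho>0$; 6. $f^{\omega^\rho}(\xi)=\lim_{\zeta\to\xi}f^{\omega^\rho}(\zeta)$ for $\xi$ a limit ordinal and $\rho>0$.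
   Context: $\mathsf{On}$ is the class of all ordinals. A function $f:\mathsf{On}\to\mathsf{On}$ is normal if it is strictly increasing and continuous, i.e. $f(\lambda)=\sup_{\xi<\lambda}f(\xi)$ for every limit ordinal $\lambda$. Limits $\lim_{\zeta\to\lambda}$ are taken along $\zeta<\lambda$ in the order topology (for non-decreasing families, this is the supremum over $\zeta<\lambda$). A weak hyperation of a normal function $f$ is a family $\langle g^\xi\rangle_{\xi\in\mathsf{On}}$ of normal functions such that $g^0=\mathrm{id}$, $g^1=f$, and $g^{\xi+\zeta}=g^\xi\circ g^\zeta$ for all ordinals $\xi,\zeta$. The hyperation of $f$, denoted $\mathrm{Hyp}[f]$, is a weak hyperation $\langle g^\xi\rangle_{\xi\in\mathsf{On}}$ of $f$ that is minimal in the sense that for every weak hyperation $\langle h^\xi\rangle_{\xi\in\mathsf{On}}$ of $f$ and all ordinals $\xi,\zeta$ one has $g^\xi(\zeta)\le h^\xi(\zeta)$. *)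

(* Defs.v *)
From Stdlib Require Import Wellfounded.
From HB Require Import structures.
From mathcomp Require Import all_boot all_order.
From mathcomp Require Import boolp classical_sets filter topology.

Set Implicit Arguments.
Unset Strict Implicit.
Unset Printing Implicit Defensive.
Set SsrOldRewriteGoalsOrder.

Import Order.TTheory.

Local Open Scope classical_set_scope.
Local Open Scope order_scope.

(* The universe of [wo_car] is the universe of "sets"; [On] below lives one
   universe higher and plays the role of the proper class of all ordinals. *)
Record woset := WOSet {
  wo_car :> Type;
  wo_lt : wo_car -> wo_car -> Prop;
  wo_wf : well_founded wo_lt;
  wo_trans : forall x y z, wo_lt x y -> wo_lt y z -> wo_lt x z;
  wo_total : forall x y, [\/ wo_lt x y, x = y | wo_lt y x] }.

Definition order_preserving (A B : woset) (f : A -> B) :=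
  forall x y, wo_lt x y -> wo_lt (f x) (f y).

(* The orders being total, the inverse is order-preserving as well. *)
Definition wo_iso (A B : woset) :=
  exists f : A -> B, bijective f /\ order_preserving f.

(* isomorphisms onto an initial segment of B *)
Definition initial_emb (A B : woset) (f : A -> B) :=
  order_preserving f /\ forall x z, wo_lt z (f x) -> exists y, z = f y.

Section WOSets.
Implicit Types A B C : woset.

Lemma wo_irrefl A (x : A) : ~ wo_lt x x.
Proof. by elim: (wo_wf x) => {}x _ IH xx; exact: (IH x xx xx). Qed.

Lemma wo_asym A (x y : A) : wo_lt x y -> ~ wo_lt y x.
Proof. by move=> xy yx; exact: (wo_irrefl (wo_trans xy yx)). Qed.

Lemma wo_min A (P : A -> Prop) : (exists x, P x) ->
  exists x, P x /\ forall y, wo_lt y x -> ~ P y.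
Proof.
case=> x; elim: (wo_wf x) => {}x _ IH Px.
have [[y [yx Py]]|ny] := pselect (exists y, wo_lt y x /\ P y).
  exact: IH yx Py.
by exists x; split=> // y yx Py; apply: ny; exists y.
Qed.

Lemma order_preserving_inj A B (f : A -> B) :
  order_preserving f -> forall x y, f x = f y -> x = y.
Proof.
move=> fm x y fxy; case: (wo_total x y) => // h; move: (fm _ _ h);
by rewrite fxy => /wo_irrefl.
Qed.

Lemma order_preservingK A B (f : A -> B) :
  order_preserving f -> forall x y, wo_lt (f x) (f y) -> wo_lt x y.
Proof.
move=> fm x y fxy; case: (wo_total x y) => // [e|/fm yx].
  by move: fxy; rewrite e => /wo_irrefl.
by case: (wo_asym fxy yx).
Qed.

Lemma surjective_iso A B (f : A -> B) : order_preserving f ->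
  (forall y, exists x, y = f x) -> wo_iso A B.
Proof.
move=> fm fs; exists f; split=> //.
pose g y := projT1 (cid (fs y)).
have fg y : f (g y) = y by rewrite /g; case: cid => x /= <-.
exists g => // x; exact: (order_preserving_inj fm (fg (f x))).
Qed.

Lemma wo_iso_emb A B : wo_iso A B ->
  exists f : A -> B, initial_emb f /\ forall y, exists x, y = f x.
Proof.
case=> f [[g fK gK] fm]; exists f; split; last by move=> y; exists (g y).
by split=> // x z _; exists (g z).
Qed.

Lemma wo_iso_refl A : wo_iso A A.
Proof. by apply: (@surjective_iso _ _ id) => // y; exists y. Qed.

Lemma wo_iso_sym A B : wo_iso A B -> wo_iso B A.
Proof.
case=> f [[g fK gK] fm]; exists g; split; first by exists f.
by move=> x y xy; apply: (order_preservingK fm); rewrite !gK.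
Qed.

Lemma wo_iso_trans A B C : wo_iso A B -> wo_iso B C -> wo_iso A C.
Proof.
case=> f [fb fm] [g [gb gm]]; exists (g \o f); split; first exact: bij_comp.
by move=> x y /fm/gm.
Qed.

Lemma initial_emb_comp A B C (f : A -> B) (g : B -> C) :
  initial_emb f -> initial_emb g -> initial_emb (g \o f).
Proof.
move=> [fm fi] [gm gi]; split=> [x y /fm/gm //|x z /= h].
have [y zy] := gi _ _ h; subst z.
have [w ->] := fi _ _ (order_preservingK gm h).
by exists w.
Qed.

Lemma initial_emb_unique A B (f g : A -> B) :
  initial_emb f -> initial_emb g -> forall x, f x = g x.
Proof.
move=> [fm fi] [gm gi] x; elim: (wo_wf x) => {}x _ IH.
case: (wo_total (f x) (g x)) => // h.
- have [y e] := gi _ _ h; rewrite e in h.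
  have yx := order_preservingK gm h.
  by have /(order_preserving_inj fm) e' := etrans (IH _ yx) (esym e);
    subst y; case: (wo_irrefl yx).
- have [y e] := fi _ _ h; rewrite e in h.
  have yx := order_preservingK fm h.
  by have /(order_preserving_inj gm) e' := etrans (esym (IH _ yx)) (esym e);
    subst y; case: (wo_irrefl yx).
Qed.

Lemma initial_emb_anti A B (f : A -> B) (g : B -> A) :
  initial_emb f -> initial_emb g -> wo_iso A B.
Proof.
move=> fi gi; apply: (surjective_iso (f := f)); first by case: fi.
move=> y; exists (g y).
have := initial_emb_unique (initial_emb_comp gi fi) (g := id).
by move=> /(_ _ y) /= -> //; split=> // x z _; exists z.
Qed.

Section Comparison.
Variables A B : woset.

Inductive match_seg (x : A) (y : B) : Prop := MatchSeg of
  (forall x', wo_lt x' x -> exists2 y', wo_lt y' y & match_seg x' y') &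
  (forall y', wo_lt y' y -> exists2 x', wo_lt x' x & match_seg x' y').

Lemma match_seg_fun x y y' :
  match_seg x y -> match_seg x y' -> ~ wo_lt y y'.
Proof.
elim: (wo_wf x) y y' => {}x _ IH y y' [m1 _] [_ m2] /m2[w wx mw].
by have [v vy mv] := m1 _ wx; exact: (IH _ wx _ _ mv mw vy).
Qed.

Lemma match_seg_lt x y x' y' :
  match_seg x y -> match_seg x' y' -> wo_lt x x' -> wo_lt y y'.
Proof.
move=> m [m1 _] /m1[v vy' mv].
case: (wo_total v y) => [vy|<- //|yv].
  by case: (match_seg_fun mv m vy).
by case: (match_seg_fun m mv yv).
Qed.

Lemma match_seg_inj x x' y : match_seg x y -> match_seg x' y -> x = x'.
Proof.
move=> m m'; case: (wo_total x x') => // h.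
  by have /wo_irrefl := match_seg_lt m m' h.
by have /wo_irrefl := match_seg_lt m' m h.
Qed.

Lemma match_seg_funE x y y' : match_seg x y -> match_seg x y' -> y = y'.
Proof.
move=> m m'; case: (wo_total y y') => // h.
  by case: (match_seg_fun m m' h).
by case: (match_seg_fun m' m h).
Qed.

Lemma wo_comparable : (exists f : A -> B, initial_emb f) \/
  (exists g : B -> A, initial_emb g).
Proof.
have [hA|/existsNP hA] := pselect (forall x, exists y, match_seg x y).
  left; pose f x := projT1 (cid (hA x)).
  have fP x : match_seg x (f x) by rewrite /f; case: cid.
  exists f; split=> [x y|x z zx]; first exact: match_seg_lt.
  have [_ m] := fP x; have [x' _ m'] := m _ zx.
  by exists x'; exact: match_seg_funE m' (fP x').
have [hB|/existsNP hB] := pselect (forall y, exists x, match_seg x y).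
  right; pose g y := projT1 (cid (hB y)).
  have gP y : match_seg (g y) y by rewrite /g; case: cid.
  exists g; split=> [y y' yy'|y z zy].
    have [_ m] := gP y'; have [u uy mu] := m _ yy'.
    by rewrite (match_seg_inj (gP y) mu).
  have [m _] := gP y; have [y' _ m'] := m _ zy.
  by exists y'; exact: match_seg_inj m' (gP y').
have [x [nx xmin]] := wo_min hA; have [y [ny ymin]] := wo_min hB.
exfalso; apply: (nx); exists y.
split=> [x' /xmin/contrapT[y' m]|y' /ymin/contrapT[x' m]].
  exists y' => //; case: (wo_total y' y) => // h; case: ny.
    by exists x'; rewrite -h.
  by case: m => _ m2; have [x'' _ ?] := m2 _ h; exists x''.
exists x' => //; case: (wo_total x' x) => // h; case: nx.
  by exists y'; rewrite -h.
by case: m => m1 _; have [y'' _ ?] := m1 _ h; exists y''.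
Qed.

End Comparison.

Lemma wo_sub_wf A (P : A -> Prop) :
  well_founded (fun x y : {x : A | P x} => wo_lt (sval x) (sval y)).
Proof. exact: wf_inverse_image (@wo_wf A). Qed.

Lemma wo_sub_total A (P : A -> Prop) (x y : {x : A | P x}) :
  [\/ wo_lt (sval x) (sval y), x = y | wo_lt (sval y) (sval x)].
Proof.
case: (wo_total (sval x) (sval y)) => h; [exact: Or31| |exact: Or33].
by apply: Or32; case: x y h => x px [y py] /= e; exact: eq_exist.
Qed.

Definition wo_sub A (P : A -> Prop) : woset :=
  @WOSet {x : A | P x} _ (@wo_sub_wf A P)
    (fun x y z => @wo_trans A (sval x) (sval y) (sval z)) (@wo_sub_total A P).

Definition wo_seg A (x : A) := wo_sub (fun y => wo_lt y x).

Lemma wo_seg_emb A (x : A) : initial_emb (fun y : wo_seg x => sval y).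
Proof.
split=> // y z zy; have zx := wo_trans zy (svalP y).
by exists (exist _ z zx).
Qed.

Lemma initial_emb_seg A B (f : A -> B) : initial_emb f -> ~ wo_iso A B ->
  exists y : B, wo_iso A (wo_seg y).
Proof.
move=> [fm fi] nAB.
have [|y [ny ymin]] := @wo_min B (fun y => ~ exists x, y = f x).
  by apply/not_existsP => h; apply: nAB; apply: (surjective_iso fm) => y;
     apply: contrapT; exact: h.
have fy x : wo_lt (f x) y.
  case: (wo_total (f x) y) => // h; case: ny; first by exists x.
  exact: fi h.
exists y; apply: (@surjective_iso A (wo_seg y)
  (fun x => exist (fun z => wo_lt z y) (f x) (fy x))) => // -[z zy].
have /contrapT[x zx] := ymin _ zy; exists x; exact: eq_exist.
Qed.

Definition wo_succ_lt A (x y : option A) :=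
  match x, y with
  | Some x, Some y => wo_lt x y
  | Some _, None => True
  | None, _ => False
  end.

Lemma wo_succ_wf A : well_founded (@wo_succ_lt A).
Proof.
have S (x : A) : Acc (@wo_succ_lt A) (Some x).
  elim: (wo_wf x) => {}x _ IH; constructor=> -[y yx|[]]; exact: IH.
by case=> [x|]; [exact: S|constructor=> -[x _|[]]; exact: S].
Qed.

Lemma wo_succ_trans A (x y z : option A) :
  wo_succ_lt x y -> wo_succ_lt y z -> wo_succ_lt x z.
Proof. by case: x y z => [x|] [y|] [z|] //=; exact: wo_trans. Qed.

Lemma wo_succ_total A (x y : option A) :
  [\/ wo_succ_lt x y, x = y | wo_succ_lt y x].
Proof.
case: x y => [x|] [y|] /=; [|exact: Or31|exact: Or33|exact: Or32].
by case: (wo_total x y) => [h|->|h]; [exact: Or31|exact: Or32|exact: Or33].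
Qed.

Definition wo_succ A : woset :=
  WOSet (@wo_succ_wf A) (@wo_succ_trans A) (@wo_succ_total A).

End WOSets.

Definition wo_empty : woset.
Proof. by exists False (fun _ _ => False) => -[]. Defined.

Lemma nat_lt_total (m n : nat) : [\/ (m < n)%N, m = n | (n < m)%N].
Proof. by case: (ltngtP m n) => h; [exact: Or31|exact: Or33|exact: Or32]. Qed.

Lemma nat_lt_wf : well_founded (fun m n : nat => (m < n)%N : Prop).
Proof.
move=> n; elim: n {-2}n (leqnn n) => [|n IH] m mn; constructor=> k km.
  by have := leq_trans km mn; rewrite ltn0.
by apply: IH; rewrite -ltnS; exact: leq_trans km mn.
Qed.

Definition wo_nat : woset :=
  WOSet nat_lt_wf (fun _ _ _ => @ltn_trans _ _ _) nat_lt_total.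

Definition On : Type := {C : set woset | exists A, C = wo_iso A}.

Definition otype (A : woset) : On := exist _ (wo_iso A) (ex_intro _ A erefl).

Definition orepr (a : On) : woset := projT1 (cid (svalP a)).

Lemma oreprK a : otype (orepr a) = a.
Proof.
rewrite /orepr; case: cid => A /= e; case: a e => C pC /= e.
by apply: eq_exist; rewrite e.
Qed.

Lemma otype_eq (A B : woset) : otype A = otype B <-> wo_iso A B.
Proof.
split=> [/(congr1 sval)/= e|AB].
  by rewrite e; exact: wo_iso_refl.
apply: eq_exist; apply/funext => C; apply/propext; split=> h.
  exact: (wo_iso_trans (wo_iso_sym AB) h).
exact: (wo_iso_trans AB h).
Qed.

HB.instance Definition _ := gen_eqMixin On.
HB.instance Definition _ := gen_choiceMixin On.

Definition ole (a b : On) : bool :=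
  `[< exists f : orepr a -> orepr b, initial_emb f >].

Lemma otype_emb (A : woset) : (exists f : A -> orepr (otype A), initial_emb f) /\
  (exists f : orepr (otype A) -> A, initial_emb f).
Proof.
have /otype_eq h := oreprK (otype A); split.
  by have [f [? _]] := wo_iso_emb (wo_iso_sym h); exists f.
by have [f [? _]] := wo_iso_emb h; exists f.
Qed.

Lemma ole_otype (A B : woset) :
  ole (otype A) (otype B) <-> exists f : A -> B, initial_emb f.
Proof.
have [[a ai] [a' ai']] := otype_emb A; have [[b bi] [b' bi']] := otype_emb B.
split=> [/asboolP[f fi]|[f fi]].
  exists (b' \o (f \o a)).
  exact: initial_emb_comp (initial_emb_comp ai fi) bi'.
apply/asboolP; exists (b \o (f \o a')).
exact: initial_emb_comp (initial_emb_comp ai' fi) bi.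
Qed.

Lemma ole_refl : reflexive ole.
Proof.
by move=> a; apply/asboolP; exists id; split=> // x z _; exists z.
Qed.

Lemma ole_anti : antisymmetric ole.
Proof.
move=> a b /andP[/asboolP[f fi] /asboolP[g gi]].
by rewrite -(oreprK a) -(oreprK b); apply/otype_eq; exact: initial_emb_anti fi gi.
Qed.

Lemma ole_trans : transitive ole.
Proof.
move=> b a c /asboolP[f fi] /asboolP[g gi]; apply/asboolP.
by exists (g \o f); exact: initial_emb_comp.
Qed.

Lemma ole_total : total ole.
Proof.
move=> a b; apply/orP; case: (wo_comparable (orepr a) (orepr b)) => h.
  by left; apply/asboolP.
by right; apply/asboolP.
Qed.

Fact ordinal_display : Order.disp_t. Proof. exact: Order.Disp tt tt. Qed.

HB.instance Definition _ :=
  Order.Le_isPOrder.Build ordinal_display On ole_refl ole_anti ole_trans.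
HB.instance Definition _ :=
  Order.POrder_isTotal.Build ordinal_display On ole_total.
HB.instance Definition _ :=
  OrderTopological.copy On (order_topology On).

Lemma lt_otype (A : woset) (b : On) :
  b < otype A <-> exists x : A, b = otype (wo_seg x).
Proof.
rewrite -(oreprK b); set B := orepr b; split.
  rewrite lt_neqAle => /andP[/eqP ne /ole_otype[f fi]].
  have [|x h] := initial_emb_seg fi; first by move/otype_eq.
  by exists x; apply/otype_eq.
move=> [x ->]; rewrite lt_neqAle; apply/andP; split; last first.
  by apply/ole_otype; exists (fun y : wo_seg x => sval y); exact: wo_seg_emb.
apply/eqP => /otype_eq/wo_iso_sym/wo_iso_emb[f [fi _]].
have := initial_emb_unique (initial_emb_comp fi (wo_seg_emb x)) (g := id).
move=> /(_ _ x) /=; have := svalP (f x) => /= + e.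
by rewrite e; [move=> /wo_irrefl|split=> // y z _; exists z].
Qed.

Lemma lt_otype_seg (A : woset) (x y : A) :
  otype (wo_seg x) < otype (wo_seg y) <-> wo_lt x y.
Proof.
have L (u v : A) : wo_lt u v -> otype (wo_seg u) < otype (wo_seg v).
  move=> uv; apply/lt_otype; exists (exist (fun z => wo_lt z v) u uv).
  apply/otype_eq.
  apply: (@surjective_iso (wo_seg u)
            (@wo_seg (wo_seg v) (exist (fun z => wo_lt z v) u uv))
            (fun z => exist _ (exist (fun z => wo_lt z v) (sval z)
               (wo_trans (svalP z) uv)) (svalP z))) => // -[[z zv] /= zu].
  by exists (exist (fun z => wo_lt z u) z zu); apply: eq_exist; exact: eq_exist.
split; last exact: L.
case: (wo_total x y) => // [->|/L yx xy]; first by rewrite ltxx.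
by have := lt_trans yx xy; rewrite ltxx.
Qed.

Lemma olt_wf : well_founded (fun a b : On => a < b).
Proof.
have S (A : woset) (x : A) : Acc (fun a b : On => a < b) (otype (wo_seg x)).
  elim: (wo_wf x) => {}x _ IH; constructor=> b bx.
  have /lt_otype[y e] : b < otype A.
    by apply: (lt_trans bx); apply/lt_otype; exists x.
  by move: bx; rewrite e => /lt_otype_seg; exact: IH.
move=> a; rewrite -(oreprK a); constructor=> b /lt_otype[x ->]; exact: S.
Qed.

Lemma olt_ind (P : On -> Prop) :
  (forall a, (forall b, b < a -> P b) -> P a) -> forall a, P a.
Proof. by move=> h a; elim: (olt_wf a) => b _; exact: h. Qed.

Lemma small_bounded (I : Type) (F : I -> woset) :
  exists b, forall i, otype (F i) <= b.
Proof.
pose T := {i : I & F i}.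
pose v (p : T) : On := otype (wo_seg (projT2 p)).
have inT (p : T) : exists q, v q = v p by exists p.
have ex (b : On) : exists P : T -> Prop, (exists p, v p = b) ->
    exists p, v p = b /\ forall q, P q /\ v q = b <-> q = p.
  have [[p vp]|n] := pselect (exists p, v p = b); last by exists xpredT.
  by exists (fun q => q = p); exists p; split=> // q; split=> [[]//|->].
pose P b := projT1 (cid (ex b)).
have PP b : (exists p, v p = b) ->
    exists p, v p = b /\ forall q, P b q /\ v q = b <-> q = p.
  by rewrite /P; case: cid.
pose U := {p : T | P (v p) p}.
have vU (p : U) (q : U) : v (sval p) = v (sval q) -> p = q.
  case: p q => [p pp] [q qq] /= e; apply: eq_exist.
  have [r [_ h]] := PP (v q) (ex_intro _ q erefl).
  by transitivity r; [apply/h; rewrite -e|apply/esym/h].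
have Uwf : well_founded (fun p q : U => v (sval p) < v (sval q)).
  exact: wf_inverse_image olt_wf.
have Utot (p q : U) : [\/ v (sval p) < v (sval q), p = q
                        | v (sval q) < v (sval p)].
  by case: (ltgtP (v (sval p)) (v (sval q))) => h;
    [exact: Or31|exact: Or33|apply: Or32; exact: vU].
pose W := @WOSet U _ Uwf
  (fun x y z => @lt_trans _ _ (v (sval y)) (v (sval x)) (v (sval z))) Utot.
have vs (p : T) : exists q : U, v (sval q) = v p.
  have [r [vr h]] := PP (v p) (ex_intro _ p erefl).
  have /h[Pr _] : r = r by [].
  by rewrite -vr in Pr; exists (exist (fun q => P (v q) q) r Pr).
exists (otype W) => i; apply/ole_otype.
pose f (x : F i) : W := projT1 (cid (vs (existT _ i x))).
have fP x : v (sval (f x)) = otype (wo_seg x) by rewrite /f; case: cid.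
exists f; split=> [x y xy|x z].
  by change (v (sval (f x)) < v (sval (f y))); rewrite !fP; apply/lt_otype_seg.
change (v (sval z) < v (sval (f x)) -> exists y, z = f y); rewrite fP => h.
have /lt_otype[y e] : v (sval z) < otype (F i).
  by apply: (lt_trans h); apply/lt_otype; exists x.
by exists y; apply: vU; rewrite fP.
Qed.

Definition ozero : On := otype wo_empty.
Definition osucc (a : On) : On := otype (wo_succ (orepr a)).
Definition oone : On := osucc ozero.
Definition omega : On := otype wo_nat.
Definition osup (A : set On) : On := supremum ozero A.
Definition is_limit (a : On) := a <> ozero /\ ~ exists b, a = osucc b.

Lemma ozero_le a : ozero <= a.
Proof.
by rewrite -(oreprK a); apply/ole_otype; exists (fun x : False => match x with end); split; case.
Qed.

Lemma olt0P a : reflect (a <> ozero) (ozero < a).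
Proof.
by rewrite lt_neqAle ozero_le andbT eq_sym; apply: (iffP idP) => /eqP.
Qed.

Lemma ltoS a b : (a < osucc b) = (a <= b).
Proof.
have e : b = otype (@wo_seg (wo_succ (orepr b)) None).
  rewrite -{1}(oreprK b); apply/otype_eq.
  apply: (@surjective_iso (orepr b) (@wo_seg (wo_succ (orepr b)) None)
     (fun x => exist (fun y : wo_succ (orepr b) => wo_lt y None) (Some x) I)) => //.
  by case=> -[x|] //= p; exists x; apply: eq_exist.
apply/idP/idP.
  move=> /lt_otype[x ->]; rewrite {2}e; case: x => [x|] //.
  by apply: ltW; apply/lt_otype_seg.
by move=> /le_lt_trans; apply; apply/lt_otype; exists None.
Qed.

Lemma lto_succ a : a < osucc a. Proof. by rewrite ltoS. Qed.

Lemma leSo a b : (osucc a <= b) = (a < b).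
Proof. by rewrite leNgt ltoS -ltNge. Qed.

Lemma osucc_inj : injective osucc.
Proof.
move=> a b e; apply/eqP; rewrite eq_le -!ltoS e lto_succ.
by rewrite -e lto_succ.
Qed.

Lemma limit_succ_lt a b : is_limit a -> b < a -> osucc b < a.
Proof.
move=> [_ h] ba; rewrite lt_neqAle leSo ba andbT; apply/eqP => e.
by apply: h; exists b.
Qed.

Lemma ordP a : [\/ a = ozero, exists b, a = osucc b | is_limit a].
Proof.
have [->|/eqP n0] := eqVneq a ozero; first exact: Or31.
have [h|h] := pselect (exists b, a = osucc b); first exact: Or32.
exact: Or33.
Qed.

Lemma has_ubound_image (f : On -> On) a : has_ubound (f @` [set b | b < a]).
Proof.
have [c hc] := small_bounded (fun x : orepr a => orepr (f (otype (wo_seg x)))).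
exists c => _ [b /= ba <-]; rewrite -(oreprK a) in ba.
by have /lt_otype[x ->] := ba; have := hc x; rewrite oreprK.
Qed.

Lemma osupP (A : set On) : has_ubound A -> supremums A (osup A).
Proof.
move=> [u uA].
have [s sA] : supremums A !=set0.
  elim/olt_ind: u uA => u IH uA.
  have [[u' u'u u'A]|n] := pselect (exists2 u', u' < u & ubound A u').
    exact: IH u'u u'A.
  exists u; split=> // w wA; rewrite leNgt; apply/negP => wu; apply: n.
  by exists w.
rewrite /osup /supremum; case: ifPn => [/eqP->|_].
  by split=> [x //|x _]; exact: ozero_le.
by case: xgetP => [x ->//|/(_ s)]; case.
Qed.

Lemma osup_ub (A : set On) a : has_ubound A -> A a -> a <= osup A.
Proof. by move=> /osupP[h _]; exact: h. Qed.

Lemma osup_le (A : set On) b :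
  (forall a, A a -> a <= b) -> osup A <= b.
Proof. by move=> h; have [|_] := @osupP A; [exists b|apply]. Qed.

Section Rec.
Variables (z : On) (s : On -> On).

Definition ord_rec_step (a : On) (r : forall b : On, b < a -> On) : On :=
  match pselect (exists b, a = osucc b) with
  | left e => s (r (projT1 (cid e))
      (eq_ind_r (fun c => projT1 (cid e) < c) (lto_succ _) (projT2 (cid e))))
  | right _ => if a == ozero then z
               else osup [set c | exists b (h : b < a), c = r b h]
  end.

Definition ord_rec : On -> On := Fix olt_wf (fun _ => On) ord_rec_step.

Lemma ord_recE a : ord_rec a = @ord_rec_step a (fun b _ => ord_rec b).
Proof.
rewrite /ord_rec Fix_eq // => x f g fg; congr ord_rec_step.
by apply/functional_extensionality_dep => b; apply/funext => h.
Qed.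

Lemma ord_rec0 : ord_rec ozero = z.
Proof.
rewrite ord_recE /ord_rec_step; case: pselect => [e|_]; last by rewrite eqxx.
by exfalso; case: e => b e; have := lto_succ b; rewrite -e ltNge ozero_le.
Qed.

Lemma ord_recS a : ord_rec (osucc a) = s (ord_rec a).
Proof.
rewrite ord_recE /ord_rec_step; case: pselect => [e|]; last first.
  by case; exists a.
by case: (cid e) => b /= /osucc_inj ->.
Qed.

Lemma ord_rec_limit a : is_limit a ->
  ord_rec a = osup (ord_rec @` [set b | b < a]).
Proof.
move=> [a0 aS]; rewrite ord_recE /ord_rec_step; case: pselect => [/aS //|_].
case: eqP => // _; congr osup; apply/seteqP; split=> c.
  by move=> [b [h ->]]; exists b.
by move=> [b /= h <-]; exists b, h.
Qed.

End Rec.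

Definition oadd (a : On) : On -> On := ord_rec a osucc.
Definition omul (a : On) : On -> On := ord_rec ozero (fun x => oadd x a).
Definition omega_pow : On -> On := ord_rec oone (fun x => omul x omega).

Definition below (a : On) : set_system On := within [set z | z < a] (nbhs a).

Definition normal (f : On -> On) :=
  {homo f : x y / x < y} /\
  forall l, is_limit l -> f l = osup (f @` [set x | x < l]).

Definition weak_hyperation (f : On -> On) (g : On -> On -> On) :=
  [/\ forall x, normal (g x),
      g ozero = id,
      g oone = f &
      forall x y, g (oadd x y) = g x \o g y].

Definition hyperation (f : On -> On) (g : On -> On -> On) :=
  weak_hyperation f g /\
  forall h, weak_hyperation f h -> forall x y, g x y <= h x y.

(* [g z @[z --> below l] --> y]: the limit exists and equals y; limits in On
   are unique since the order topology is Hausdorff. *)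
Record hyperation_recursion (f : On -> On) (g : On -> On -> On) : Prop := {
  hyp_rec0 : forall x, g ozero x = x;
  hyp_rec1 : g oone = f;
  hyp_recD : forall r x, ozero < x -> x < oadd (omega_pow r) x ->
    g (oadd (omega_pow r) x) = g (omega_pow r) \o g x;
  hyp_rec_omega0 : forall r, ozero < r ->
    g z ozero @[z --> below (omega_pow r)] --> g (omega_pow r) ozero;
  hyp_rec_omegaS : forall r x, ozero < r ->
    g z (osucc (g (omega_pow r) x)) @[z --> below (omega_pow r)]
      --> g (omega_pow r) (osucc x);
  hyp_rec_omega_limit : forall r x, ozero < r -> is_limit x ->
    g (omega_pow r) z @[z --> below x] --> g (omega_pow r) x }.

(* Main.v *)
(* Write [w s] for [omega_pow s]. By induction on [s] one shows that
   [F (w s)] is normal and is fixed by composition on the left with [F (w r)]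
   for [r < s]: each value of [F (w s)] is a supremum of values [F z b] with
   [z < w s], on which [F (w r)] acts by [F z b |-> F (w r + z) b], and
   [w r + z < w s]. Together with the Cantor normal form this gives
   [F (x + y) = F x \o F y]. For minimality, let [h] be a weak hyperation: as
   [z + w s = w s] for [z < w s], the values of [h (w s)] are fixed points of
   all the [h z], whereas [F (w s)] takes the least values this allows.
   Uniqueness is antisymmetry.

   The clauses of the recursion are limits, whose existence depends on the
   monotonicity of [F] in its exponent, itself obtained along the induction; a
   solution is therefore constructed with suprema in place of limits. *)

From HB Require Import structures.
From mathcomp Require Import all_boot all_order interval.
From mathcomp Require Import boolp classical_sets filter topology.
Require Import Defs.

Set Implicit Arguments.
Unset Strict Implicit.
Unset Printing Implicit Defensive.

Import Order.TTheory.

Local Open Scope classical_set_scope.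
Local Open Scope order_scope.

(** * Suprema over initial segments, and normal functions *)

Definition sup_below (l : On) (u : On -> On) : On :=
  osup (u @` [set x | x < l]).

Lemma sup_below_ub l u x : x < l -> u x <= sup_below l u.
Proof. by move=> xl; apply: osup_ub; [exact: has_ubound_image|exists x]. Qed.

Lemma sup_below_le l u b : (forall x, x < l -> u x <= b) -> sup_below l u <= b.
Proof. by move=> h; apply: osup_le => _ [x /= xl <-]; exact: h. Qed.

Lemma lt_sup_below l u c : c < sup_below l u -> exists2 x, x < l & c < u x.
Proof.
move=> cs; apply: contrapT => h; move: cs; apply/negP; rewrite -leNgt.
apply: sup_below_le => x xl; rewrite leNgt; apply/negP => cu; apply: h.
by exists x.
Qed.

Lemma is_limit_gt0 l : is_limit l -> ozero < l.
Proof. by case=> l0 _; exact/olt0P. Qed.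

(** The induction that proves monotonicity supplies, at each limit, the monotonicity below it that
    the limit clause may assume. *)
Lemma normal_increasing (g : On -> On) :
  (forall x, g x < g (osucc x)) ->
  (forall l, is_limit l -> (forall x y, x < y -> y < l -> g x < g y) ->
     g l = sup_below l g) ->
  normal g.
Proof.
move=> gS gl.
have gm : {homo g : x y / x < y}.
  move=> x y; elim/olt_ind: y x => y IH x.
  case: (ordP y) => [->|[b yE]|ly] xy.
  - by move: xy; rewrite ltNge ozero_le.
  - move: xy; rewrite yE ltoS le_eqVlt => /predU1P[->//|xb].
    by apply: lt_trans (gS b); apply: IH => //; rewrite yE lto_succ.
  - rewrite (gl _ ly) => [|a b ab bl]; last exact: IH.
    by apply: lt_le_trans (gS x) _; apply: sup_below_ub; exact: limit_succ_lt.
by split=> // l ll; apply: gl => // x y xy _; exact: gm.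
Qed.

Lemma ord_rec_normal z s :
  (forall x, ord_rec z s x < s (ord_rec z s x)) -> normal (ord_rec z s).
Proof.
move=> h; apply: normal_increasing => [x|l ll _]; first by rewrite ord_recS.
exact: ord_rec_limit.
Qed.

Section NormalFunctions.
Variable g : On -> On.
Hypothesis ng : normal g.

Lemma normal_mono : {mono g : x y / x <= y}.
Proof. by apply: le_mono; case: ng. Qed.

Lemma normal_ge x : x <= g x.
Proof.
elim/olt_ind: x => x IH; rewrite leNgt; apply/negP => gx.
by have := IH _ gx; rewrite normal_mono leNgt gx.
Qed.

(** A zero or successor supremum is attained, so monotonicity suffices; a limit one is handled by
    continuity. For [l = ozero] the two sides would be [g ozero] and [ozero]. *)
Lemma normal_sup_below l u : ozero < l ->
  g (sup_below l u) = sup_below l (g \o u).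
Proof.
move=> l0; apply/eqP; rewrite eq_le; apply/andP; split; last first.
  by apply: sup_below_le => x xl /=; rewrite normal_mono; exact: sup_below_ub.
have attained x : x < l -> sup_below l u <= u x ->
    g (sup_below l u) <= sup_below l (g \o u).
  move=> xl h; apply: le_trans (sup_below_ub (g \o u) xl) => /=.
  by rewrite normal_mono.
case: (ordP (sup_below l u)) => [s0|[b sE]|sl].
- by apply: attained l0 _; rewrite s0 ozero_le.
- have [x xl bx] : exists2 x, x < l & b < u x.
    by apply: lt_sup_below; rewrite sE lto_succ.
  by apply: attained xl _; rewrite sE leSo.
- case: ng => _ /(_ _ sl) ->; apply: sup_below_le => y /lt_sup_below[x xl yx].
  apply: le_trans (sup_below_ub (g \o u) xl) => /=.
  by rewrite normal_mono ltW.
Qed.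

End NormalFunctions.

Lemma normal_id : normal id.
Proof.
split=> // l ll; apply/eqP; rewrite eq_le; apply/andP; split; last first.
  by apply: sup_below_le => x; exact: ltW.
rewrite leNgt; apply/negP => h; have := limit_succ_lt ll h.
by move=> /(sup_below_ub id); rewrite leSo ltxx.
Qed.

Lemma normal_comp g h : normal g -> normal h -> normal (g \o h).
Proof.
move=> ng nh; split=> [x y xy|l ll]; first by apply: (ng.1); exact: nh.1.
have := nh.2 _ ll; rewrite -/(sup_below l h) /= => ->.
exact: normal_sup_below (is_limit_gt0 ll).
Qed.

(** The least ordinal at which [g] exceeds [x] is not zero, by hypothesis, nor a limit, by
    continuity; [r] is its predecessor. *)
Lemma normal_bracket g x : normal g -> g ozero <= x ->
  exists r, g r <= x /\ x < g (osucc r).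
Proof.
move=> ng g0.
suff H r : x < g r -> exists r, g r <= x /\ x < g (osucc r).
  by apply: (H (osucc x)); rewrite -leSo; exact: normal_ge.
elim/olt_ind: r => r IH xr.
case: (ordP r) => [r0|[b rE]|lr].
- by move: xr; rewrite r0 ltNge g0.
- have [gb|xb] := leP (g b) x; first by exists b; rewrite -rE.
  by apply: (IH b) => //; rewrite rE lto_succ.
- have [b br xb] : exists2 b, b < r & x < g b.
    by apply: lt_sup_below; rewrite /sup_below -(ng.2 _ lr).
  exact: IH br xb.
Qed.

(** * Ordinal arithmetic and powers of [omega] *)

Lemma oadd_normal a : normal (oadd a).
Proof. by apply: ord_rec_normal => x; exact: lto_succ. Qed.

Lemma oadd0 a : oadd a ozero = a. Proof. exact: ord_rec0. Qed.

Lemma oaddS a b : oadd a (osucc b) = osucc (oadd a b).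
Proof. exact: ord_recS. Qed.

Lemma oadd_limit a l : is_limit l -> oadd a l = sup_below l (oadd a).
Proof. exact: ord_rec_limit. Qed.

Lemma leo_add2l a b c : (oadd a b <= oadd a c) = (b <= c).
Proof. exact/normal_mono/oadd_normal. Qed.

Lemma lto_add2l a b c : (oadd a b < oadd a c) = (b < c).
Proof. by rewrite !ltNge leo_add2l. Qed.

Lemma oaddI a : injective (oadd a).
Proof.
move=> b c e; apply: le_anti.
by rewrite -(leo_add2l a b c) -(leo_add2l a c b) e lexx.
Qed.

Lemma leo_addr a b : a <= oadd a b.
Proof. by rewrite -{1}(oadd0 a) leo_add2l ozero_le. Qed.

Lemma leo_addl a b : b <= oadd a b.
Proof. exact/normal_ge/oadd_normal. Qed.

Lemma oaddA a b c : oadd a (oadd b c) = oadd (oadd a b) c.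
Proof.
elim/olt_ind: c => c IH; case: (ordP c) => [->|[d cE]|lc].
- by rewrite !oadd0.
- by rewrite cE !oaddS IH // cE lto_succ.
- rewrite (oadd_limit b lc) (oadd_limit _ lc).
  rewrite normal_sup_below; [|exact: oadd_normal|exact: is_limit_gt0].
  by congr osup; apply/seteqP; split=> x [d /= dc <-]; exists d => //=;
    rewrite IH.
Qed.

Lemma add0o a : oadd ozero a = a.
Proof.
elim/olt_ind: a => a IH; case: (ordP a) => [->|[d aE]|la].
- exact: oadd0.
- by rewrite aE oaddS IH // aE lto_succ.
- rewrite oadd_limit // [RHS](normal_id.2 _ la).
  by congr osup; apply/seteqP; split=> x [d /= da <-]; exists d => //=;
    rewrite IH.
Qed.

Lemma leo_add2r a b c : a <= b -> oadd a c <= oadd b c.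
Proof.
move=> ab; elim/olt_ind: c => c IH; case: (ordP c) => [->|[d cE]|lc].
- by rewrite !oadd0.
- by rewrite cE !oaddS leSo ltoS IH // cE lto_succ.
- rewrite oadd_limit //; apply: sup_below_le => d dc.
  by apply: le_trans (IH _ dc) _; rewrite leo_add2l ltW.
Qed.

(** Consecutive values of [oadd a] differ by one, so bracketing [b] between two of them hits it
    exactly. *)
Lemma le_oaddP a b : a <= b -> exists c, b = oadd a c.
Proof.
move=> ab; have [|r [rb br]] := normal_bracket (x := b) (oadd_normal a).
  by rewrite oadd0.
by exists r; apply: le_anti; rewrite rb andbT -ltoS -oaddS.
Qed.

Lemma omul0 a : omul a ozero = ozero. Proof. exact: ord_rec0. Qed.

Lemma omulS a b : omul a (osucc b) = oadd (omul a b) a.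
Proof. exact: ord_recS. Qed.

Lemma omul1 a : omul a oone = a.
Proof. by rewrite omulS omul0 add0o. Qed.

Lemma otype_seg_natS n :
  otype (@wo_seg wo_nat n.+1) = osucc (otype (@wo_seg wo_nat n)).
Proof.
apply: le_anti; rewrite leSo; apply/andP; split; last exact/lt_otype_seg/ltnSn.
rewrite leNgt; apply/negP => h.
have /lt_otype[k kE] : osucc (otype (@wo_seg wo_nat n)) < otype wo_nat.
  by apply: lt_trans h _; apply/lt_otype; exists n.+1.
move: h (lto_succ (otype (@wo_seg wo_nat n))); rewrite kE.
move=> /lt_otype_seg /= kn /lt_otype_seg /= nk.
by move: (leq_trans kn nk); rewrite ltnn.
Qed.

Lemma otype_seg_nat0 : otype (@wo_seg wo_nat 0%N) = ozero.
Proof.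
by apply: contrapT => /olt0P/lt_otype[[k]].
Qed.

Lemma omega_limit : is_limit omega.
Proof.
have h b : b < omega -> osucc b < omega.
  move=> /lt_otype[n ->]; rewrite -otype_seg_natS.
  by apply/lt_otype; exists n.+1.
split=> [e|[b e]].
  suff : ozero < omega by rewrite e ltxx.
  by apply/lt_otype; exists 0%N; rewrite otype_seg_nat0.
by have := h b; rewrite e lto_succ ltxx => /(_ isT).
Qed.

Lemma omega_ind (P : On -> Prop) : P ozero ->
  (forall b, b < omega -> P b -> P (osucc b)) -> forall b, b < omega -> P b.
Proof.
move=> P0 PS b /lt_otype[n ->]; elim: n => [|n IH].
  by rewrite otype_seg_nat0.
by rewrite otype_seg_natS; apply: PS => //; apply/lt_otype; exists n.
Qed.

(** Restricted to finite [b]: from [omega] on, a summand added on the left may be absorbed. *)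
Lemma omulS_omega a b : b < omega -> omul a (osucc b) = oadd a (omul a b).
Proof.
move: b; apply: omega_ind => [|b _ IH]; first by rewrite omul1 omul0 oadd0.
by rewrite omulS {1}IH -oaddA -omulS.
Qed.

(** If [x] absorbs [a], adding [a] on the left keeps a multiple at most [x]; so all finite multiples
    are bounded by [x]. *)
Lemma omul_omega_le a x : oadd a x = x -> omul a omega <= x.
Proof.
move=> ax; rewrite [omul a omega](ord_rec_limit _ _ omega_limit).
apply: sup_below_le; apply: omega_ind => [|b bw IH].
  by rewrite -/(omul a _) omul0 ozero_le.
by rewrite -/(omul a _) omulS_omega // -ax leo_add2l.
Qed.

Lemma oadd_omul_omega a : oadd a (omul a omega) = omul a omega.
Proof.
apply: le_anti; rewrite leo_addl andbT.
rewrite {1}[omul a omega](ord_rec_limit _ _ omega_limit).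
rewrite -/(sup_below omega (omul a)) normal_sup_below; last 2 first.
- exact: oadd_normal.
- exact: is_limit_gt0 omega_limit.
apply: sup_below_le => b bw /=; rewrite -omulS_omega //.
rewrite [omul a omega](ord_rec_limit _ _ omega_limit).
by apply: (sup_below_ub (omul a)); exact: limit_succ_lt omega_limit bw.
Qed.

Lemma omega_pow0 : omega_pow ozero = oone. Proof. exact: ord_rec0. Qed.

Lemma omega_powS r : omega_pow (osucc r) = omul (omega_pow r) omega.
Proof. exact: ord_recS. Qed.

Lemma omega_pow_gt0 r : ozero < omega_pow r.
Proof.
elim/olt_ind: r => r IH; case: (ordP r) => [->|[b rE]|lr].
- by rewrite omega_pow0 lto_succ.
- have b0 : ozero < omega_pow b by apply: IH; rewrite rE lto_succ.
  rewrite rE omega_powS; apply: lt_le_trans b0 _.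
  by rewrite -oadd_omul_omega leo_addr.
- have := IH _ (is_limit_gt0 lr) => /lt_le_trans; apply.
  rewrite [omega_pow r](ord_rec_limit _ _ lr).
  exact: (sup_below_ub omega_pow (is_limit_gt0 lr)).
Qed.

Lemma omega_pow_normal : normal omega_pow.
Proof.
apply: ord_rec_normal => x; rewrite -/(omega_pow x).
rewrite -oadd_omul_omega -{1}(oadd0 (omega_pow x)) lto_add2l.
by apply: lt_le_trans (omega_pow_gt0 x) _; rewrite -oadd_omul_omega leo_addr.
Qed.

Lemma omega_pow_le r s : (omega_pow r <= omega_pow s) = (r <= s).
Proof. exact/normal_mono/omega_pow_normal. Qed.

Lemma omega_pow_lt r s : (omega_pow r < omega_pow s) = (r < s).
Proof. by rewrite !ltNge omega_pow_le. Qed.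

(** Additive indecomposability. At a successor, [x] lies below a finite multiple of [w], which
    [omul w omega] absorbs; at a limit, [x] lies below a smaller power, to which the induction
    applies. *)
Lemma oadd_omega_pow x s : x < omega_pow s ->
  oadd x (omega_pow s) = omega_pow s.
Proof.
move=> xs; apply: le_anti; rewrite leo_addl andbT.
elim/olt_ind: s x xs => s IH x; case: (ordP s) => [->|[b sE]|ls].
- rewrite omega_pow0 ltoS => x0; have -> : x = ozero.
    by apply: le_anti; rewrite x0 ozero_le.
  by rewrite add0o.
- rewrite sE omega_powS; set w := omega_pow b => xw.
  have [c cw xc] : exists2 c, c < omega & x < omul w c.
    by apply: lt_sup_below; rewrite /sup_below -(ord_rec_limit _ _ omega_limit).
  apply: le_trans (leo_add2r _ (ltW xc)) _.
  suff -> : oadd (omul w c) (omul w omega) = omul w omega by [].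
  move: c cw {xc}; apply: omega_ind => [|c _ IHc]; first by rewrite omul0 add0o.
  by rewrite omulS -oaddA oadd_omul_omega.
- move=> xs; have [r rs xr] : exists2 r, r < s & x < omega_pow r.
    by apply: lt_sup_below; rewrite /sup_below -(ord_rec_limit _ _ ls).
  rewrite {1}[omega_pow s](ord_rec_limit _ _ ls) -/omega_pow -/(sup_below s _).
  rewrite normal_sup_below; [|exact: oadd_normal|exact: is_limit_gt0].
  apply: sup_below_le => t ts /=.
  have [tr|rt] := leP t r.
    apply: (@le_trans _ _ (oadd x (omega_pow r))).
      by rewrite leo_add2l omega_pow_le.
    by apply: le_trans (IH _ rs _ xr) _; rewrite omega_pow_le ltW.
  apply: le_trans (IH _ ts _ _) _; last by rewrite omega_pow_le ltW.
  by apply: lt_trans xr _; rewrite omega_pow_lt.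
Qed.

Lemma oadd_lt_omega_pow x y s :
  x < omega_pow s -> y < omega_pow s -> oadd x y < omega_pow s.
Proof. by move=> xs ys; rewrite -(oadd_omega_pow xs) lto_add2l. Qed.

Lemma omega_pow_limit s : ozero < s -> is_limit (omega_pow s).
Proof.
move=> s0; split=> [|[b bE]]; first exact/olt0P/omega_pow_gt0.
have : oadd b oone < omega_pow s.
  apply: oadd_lt_omega_pow; first by rewrite bE lto_succ.
  by rewrite -omega_pow0 omega_pow_lt.
by rewrite oaddS oadd0 bE ltxx.
Qed.

(** Split off the largest power of [omega] not above [x]. Were the remainder [x] itself, [x] would
    absorb this power and so reach the next one. *)
Lemma leading_exponent x : x <> ozero ->
  exists r y, [/\ x = oadd (omega_pow r) y & y < x].
Proof.
move=> /olt0P x0.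
have [|r [rx xr]] := normal_bracket (x := x) omega_pow_normal.
  by rewrite omega_pow0 leSo.
have [y xE] := le_oaddP rx; exists r, y; split=> //.
rewrite lt_neqAle {2}xE leo_addl andbT; apply/eqP => yx.
move: xr; rewrite ltNge omega_powS omul_omega_le //.
by rewrite {2}xE yx.
Qed.

(** If [x] reached the next power, it would absorb [omega_pow r], and left cancellation would give
    [y = x]. *)
Lemma leading_exponent_lt r y x :
  x = oadd (omega_pow r) y -> y < x -> x < omega_pow (osucc r).
Proof.
move=> xE yx; rewrite ltNge; apply/negP => /le_oaddP[z xz].
have e : oadd (omega_pow r) x = x.
  by rewrite xz oaddA oadd_omega_pow // omega_pow_lt lto_succ.
by move: yx; rewrite (oaddI (etrans e xE)) ltxx.
Qed.

(** Used in both directions, this makes the leading exponent unique. *)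
Lemma leading_exponent_le r t x y :
  oadd (omega_pow r) x = oadd (omega_pow t) y -> y < oadd (omega_pow r) x ->
  r <= t.
Proof.
move=> E yx; rewrite -ltoS -omega_pow_lt.
by apply: le_lt_trans (leading_exponent_lt E yx); exact: leo_addr.
Qed.

(** * Limits in the order topology as suprema *)

(* [ozero] has no predecessor to serve as [c], hence the second case. *)
Lemma nbhs_left (y : On) (U : set On) : nbhs y U ->
  (exists2 c, c < y & forall x, c < x -> x <= y -> U x) \/
  (forall x, x <= y -> U x).
Proof.
rewrite itv_nbhsE => -[[a b] [/= oi]]; rewrite itv_boundlr => /andP[ay yb] sU.
have xb x : x <= y -> (BRight x <= b)%O.
  by move=> xy; apply: le_trans yb; rewrite bnd_simp.
case: a oi ay sU => [[] c|[]] oi ay sU; last 2 first.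
- by right=> x xy; apply: sU; rewrite /= itv_boundlr xb.
- by [].
- by case/orP: oi.
- left; exists c => [|x cx xy]; first by move: ay; rewrite bnd_simp.
  by apply: sU; rewrite /= itv_boundlr bnd_simp cx xb.
Qed.

Lemma belowP l (U : set On) : is_limit l ->
  below l U <-> exists2 c, c < l & forall x, c < x -> x < l -> U x.
Proof.
move=> ll; split=> [/nbhs_left[[c cl h]|h]|[c cl h]].
- by exists c => // x cx xl; exact: h cx (ltW xl) xl.
- by exists ozero => [|x _ xl]; [exact: is_limit_gt0|exact: h (ltW xl) xl].
- rewrite /below /within; apply: (@filterS _ (nbhs l) _ [set` `]c, +oo[]).
    by move=> x; rewrite /= in_itv /= andbT => cx xl; exact: h.
  by apply: open_nbhs_nbhs; split; [exact: rray_open|rewrite /= in_itv /= cl].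
Qed.

(** Translates the limit clauses of the recursion into suprema and back. A limit must equal the
    supremum because the topology is Hausdorff and [below l] is a proper filter. *)
Lemma cvg_below l u (y : On) : is_limit l ->
  (forall x x', x <= x' -> x' < l -> u x <= u x') ->
  u z @[z --> below l] --> y <-> y = sup_below l u.
Proof.
move=> ll um.
have cvgs : u z @[z --> below l] --> sup_below l u.
  move=> U /nbhs_left[[c cs h]|h]; apply/belowP => //; last first.
    exists ozero => [|x _ xl]; first exact: is_limit_gt0.
    by apply: h; exact: sup_below_ub.
  have [x xl cx] := lt_sup_below cs; exists x => // z xz zl.
  apply: h; first by apply: lt_le_trans cx _; apply: um => //; exact: ltW.
  exact: sup_below_ub.
split=> [cvgy|->//]; apply: (cvg_unique (@order_hausdorff _ On)) cvgy cvgs.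
apply: fmap_proper_filter; apply: Build_ProperFilter.
  by move=> /(belowP _ ll)[c cl /(_ _ (lto_succ c) (limit_succ_lt ll cl))].
Qed.

(** * Induction on the exponents of powers of [omega] *)

Section Hyperation.
Variables (f : On -> On) (F : On -> On -> On).

(** Common ground of an arbitrary solution of the recursion and the one constructed with suprema;
    the last clause admits [x = ozero]. *)
Definition hyp_base := [/\ F ozero = id, normal (F oone) & forall r x,
  x < oadd (omega_pow r) x ->
  F (oadd (omega_pow r) x) = F (omega_pow r) \o F x].

Definition good s := normal (F (omega_pow s)) /\
  forall r, r < s -> F (omega_pow r) \o F (omega_pow s) = F (omega_pow s).

(* The last clause assumes monotonicity below [l] so that it can be derived from
   convergence at [l], which gives the supremum only for monotone families. *)
Definition sup_clauses s :=
  [/\ F (omega_pow s) ozero = sup_below (omega_pow s) (F^~ ozero),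
      forall x, F (omega_pow s) (osucc x) =
        sup_below (omega_pow s) (F^~ (osucc (F (omega_pow s) x))) &
      forall l, is_limit l ->
        (forall x y, x < y -> y < l -> F (omega_pow s) x < F (omega_pow s) y) ->
        F (omega_pow s) l = sup_below l (F (omega_pow s))].

Hypothesis base : hyp_base.

Section Below.
Variable s : On.
Hypothesis goodP : forall r, r < s -> good r.

Lemma below_normal x : x < omega_pow s -> normal (F x).
Proof.
have [F0 _ FD] := base.
elim/olt_ind: x => x IH xs; have [->|/eqP x0] := eqVneq x ozero.
  by rewrite F0; exact: normal_id.
have [r [y [xE yx]]] := leading_exponent x0.
rewrite xE FD -?xE //; apply: normal_comp; last exact: IH (lt_trans yx xs).
apply: (goodP _).1; rewrite -omega_pow_lt; apply: le_lt_trans xs.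
by rewrite xE leo_addr.
Qed.

(* If [omega_pow r] is absorbed by [y], then the leading exponent [t] of [y]
   exceeds [r], and [F (omega_pow r)] fixes the range of [F (omega_pow t)]. *)
Lemma below_addw r y : y < omega_pow s -> r < s ->
  F (oadd (omega_pow r) y) = F (omega_pow r) \o F y.
Proof.
have [_ _ FD] := base; move=> ys rs.
have [/FD//|yr] := ltP y (oadd (omega_pow r) y).
have {}yr : oadd (omega_pow r) y = y by apply: le_anti; rewrite yr leo_addl.
have y0 : y <> ozero.
  by apply/olt0P; rewrite -yr;
    exact: lt_le_trans (omega_pow_gt0 r) (leo_addr _ _).
have [t [z [yE zy]]] := leading_exponent y0.
have rt : r < t.
  rewrite -leSo -ltoS -omega_pow_lt omega_powS.
  exact: le_lt_trans (omul_omega_le yr) (leading_exponent_lt yE zy).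
have ts : t < s.
  by rewrite -omega_pow_lt; apply: le_lt_trans ys; rewrite yE leo_addr.
have Fy : F y = F (omega_pow t) \o F z by rewrite yE FD -?yE.
by rewrite yr Fy compA ((goodP ts).2 _ rt).
Qed.

(** The terms of the Cantor normal form of [x] are moved across one at a time by [below_addw]. *)
Lemma below_add x y : x < omega_pow s -> y < omega_pow s ->
  F (oadd x y) = F x \o F y.
Proof.
have [F0 _ FD] := base.
elim/olt_ind: x => x IH xs ys; have [->|/eqP x0] := eqVneq x ozero.
  by rewrite F0 add0o.
have [r [z [xE zx]]] := leading_exponent x0.
have rs : r < s.
  by rewrite -omega_pow_lt; apply: le_lt_trans xs; rewrite xE leo_addr.
have zs := lt_trans zx xs.
have -> : F x = F (omega_pow r) \o F z by rewrite xE FD -?xE.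
by rewrite -compA -IH // xE -oaddA below_addw //; exact: oadd_lt_omega_pow.
Qed.

(** With [x' = oadd x z], the right side is [F x (F z y)], and the normal function [F z] satisfies
    [y <= F z y]. *)
Lemma below_mono x x' y : x <= x' -> x' < omega_pow s -> F x y <= F x' y.
Proof.
move=> xx' x's; have [z x'E] := le_oaddP xx'.
have zs : z < omega_pow s by apply: le_lt_trans x's; rewrite x'E leo_addl.
have xs := le_lt_trans xx' x's.
rewrite x'E below_add //= (normal_mono (below_normal xs)).
exact/normal_ge/below_normal.
Qed.

Lemma good_step : ozero < s -> sup_clauses s -> good s.
Proof.
have [F0 _ _] := base; move=> s0 [F_0 F_S F_l].
have n : normal (F (omega_pow s)).
  apply: normal_increasing F_l => x; rewrite F_S -leSo.
  (* As [F ozero] is [id], the term at [ozero] already exceeds [F (omega_pow s) x]. *)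
  have := @sup_below_ub (omega_pow s) (F^~ (osucc (F (omega_pow s) x))) ozero.
  by rewrite F0; apply; exact: omega_pow_gt0.
split=> // r rs; apply/funext => x /=.
have rs' : omega_pow r < omega_pow s by rewrite omega_pow_lt.
have nr : normal (F (omega_pow r)) := (goodP rs).1.
have fix_sup y : F (omega_pow r) (sup_below (omega_pow s) (F^~ y)) =
    sup_below (omega_pow s) (F^~ y).
  apply: le_anti; rewrite (normal_ge nr) andbT.
  rewrite normal_sup_below //; last exact: omega_pow_gt0.
  apply: sup_below_le => z zs /=.
  have := below_add rs' zs => /(congr1 (@^~ y)) /= <-.
  by apply: (sup_below_ub (F^~ y)); exact: oadd_lt_omega_pow.
elim/olt_ind: x => x IH; case: (ordP x) => [->|[b ->]|lx].
- by rewrite F_0.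
- by rewrite F_S.
- rewrite (n.2 _ lx) -/(sup_below x _) (normal_sup_below nr); last first.
    exact: is_limit_gt0.
  by congr osup; apply/seteqP; split=> y [z /= zx <-]; exists z => //=;
    rewrite IH.
Qed.

End Below.

Lemma good0 : good ozero.
Proof.
have [_ n1 _] := base; rewrite /good omega_pow0; split=> // r.
by rewrite ltNge ozero_le.
Qed.

Lemma sup_clauses_good : (forall s, ozero < s -> (forall r, r < s -> good r) ->
  sup_clauses s) -> forall s, good s.
Proof.
move=> h; elim/olt_ind => s IH; have [->|/eqP/olt0P s0] := eqVneq s ozero.
  exact: good0.
by apply: good_step => //; exact: h.
Qed.

Lemma good_hyperation : F oone = f -> (forall s, good s) ->
  (forall s, ozero < s -> sup_clauses s) -> hyperation f F.
Proof.
have [F0 _ _] := base; move=> F1 gF sF.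
have big x y : exists s, x < omega_pow s /\ y < omega_pow s.
  (* Any [s] satisfies [s <= omega_pow s], so a strict bound of [x] and [y] can serve as the
     exponent. *)
  exists (osucc (Order.max x y)).
  by split; apply: lt_le_trans (normal_ge omega_pow_normal _);
    rewrite ltoS le_max lexx ?orbT.
split.
  split=> // [x|x y].
    have [s [xs ys]] := big x ozero.
    exact: (@below_normal s).
  by have [s [xs ys]] := big x y; exact: (@below_add s).
move=> h [nh h0 h1 hD] x; elim/olt_ind: x => x IH.
have [->|/eqP x0] := eqVneq x ozero; first by move=> y; rewrite F0 h0.
have [r [z [xE zx]]] := leading_exponent x0.
(* Unless [x] is a power of [omega], both parts of the decomposition are smaller, and the two bounds
   compose. *)
have [xr|rx] := eqVneq x (omega_pow r); last first.
  have rx' : omega_pow r < x by rewrite lt_neqAle eq_sym rx xE leo_addr.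
  move=> y; rewrite xE hD.
  have [_ _ -> /=] := base; last by rewrite -xE.
  apply: le_trans (_ : F (omega_pow r) (h z y) <= _); last exact: IH.
  by rewrite (normal_mono (gF r).1) IH.
have [r0|/eqP/olt0P r0] := eqVneq r ozero.
  by move=> y; rewrite xr r0 omega_pow0 F1 h1.
have hfix z' y : z' < omega_pow r ->
    h z' (h (omega_pow r) y) = h (omega_pow r) y.
  by move=> z'r; have := hD z' (omega_pow r);
    rewrite oadd_omega_pow // => /(congr1 (@^~ y)) /= <-.
have [F_0 F_S _] := sF _ r0.
(* Inner induction on the argument: by the bounds at smaller arguments, each term [F z' _] of a
   supremum is at most [h z'] of its own fixed point [h (omega_pow r) y]. *)
move=> y; rewrite xr; elim/olt_ind: y => y IHy.
case: (ordP y) => [->|[b yE]|ly].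
- rewrite F_0; apply: sup_below_le => z' z'r.
  rewrite -(hfix z') //; apply: le_trans (IH z' _ _) _; first by rewrite xr.
  by rewrite (normal_mono (nh z')) ozero_le.
- rewrite yE F_S; apply: sup_below_le => z' z'r.
  rewrite -(hfix z') //; apply: le_trans (IH z' _ _) _; first by rewrite xr.
  rewrite (normal_mono (nh z')) leSo; apply: le_lt_trans (IHy b _) _.
    by rewrite yE lto_succ.
  by apply: (nh _).1; exact: lto_succ.
- rewrite ((gF r).1.2 _ ly); apply: sup_below_le => b bly.
  by apply: le_trans (IHy b bly) _; rewrite (normal_mono (nh _)) ltW.
Qed.

End Hyperation.

Lemma recursion_hyperation f F :
  normal f -> hyperation_recursion f F -> hyperation f F.
Proof.
move=> nf [F0 F1 FD F_0 F_S F_l].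
have base : hyp_base F.
  split=> [||r x xr]; [exact/funext|by rewrite F1|].
  have [->|/eqP/olt0P x0] := eqVneq x ozero; last exact: FD.
  by rewrite oadd0; apply/funext => y /=; rewrite F0.
have sF s : ozero < s -> (forall r, r < s -> good F r) -> sup_clauses F s.
  move=> s0 gs; have ls := omega_pow_limit s0.
  (* Goodness below [s] already yields monotonicity in exponents below [omega_pow s], so the limits
     at this stage are suprema. *)
  have mono y x x' := below_mono base gs (x := x) (x' := x') y.
  split=> [|x|l ll incr].
  - by apply/(cvg_below _ ls (mono _)); exact: F_0.
  - by apply/(cvg_below _ ls (mono _)); exact: F_S.
  - apply/(cvg_below _ ll); last exact: F_l.
    by move=> x y; rewrite le_eqVlt => /predU1P[->//|xy] yl; apply/ltW/incr.
have gF := sup_clauses_good base sF.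
by apply: (good_hyperation base F1 gF) => s s0; exact: sF.
Qed.

(** * Existence of a solution, and uniqueness *)

(** The guard [y < x] with default [d] keeps proof arguments out of the step [G]. *)
Lemma bounded_rec (T : Type) (d : T) (G : On -> (On -> T) -> T) :
  exists F : On -> T, forall x, F x = G x (fun y => if y < x then F y else d).
Proof.
pose step (x : On) (r : forall y : On, y < x -> T) : T :=
  G x (fun y => if pselect (y < x) is left h then r y h else d).
exists (Fix olt_wf (fun=> T) step) => x.
rewrite Fix_eq => [|{}x r r' rr']; last first.
  by congr G; apply/funext => y; case: pselect => // h; exact: rr'.
by rewrite {1}/step; congr G; apply/funext => y;
  case: pselect => [->|/negP/negbTE->].
Qed.

Lemma exists_recursion f : normal f -> exists F, hyperation_recursion f F.
Proof.
move=> nf.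
pose jump (l : On) (R : On -> On -> On) : On -> On :=
  ord_rec (sup_below l (R^~ ozero)) (fun v => sup_below l (R^~ (osucc v))).
(* The two inequalities exclude the powers of [omega] and keep both indices where [R] holds
   recursive values. *)
pose split_at (x : On) (p : On * On) :=
  [/\ x = oadd (omega_pow p.1) p.2, p.2 < x & omega_pow p.1 < x].
pose G (x : On) (R : On -> On -> On) : On -> On :=
  match pselect (exists p, split_at x p) with
  | left e => R (omega_pow (projT1 (cid e)).1) \o R (projT1 (cid e)).2
  | right _ => if x == ozero then id else if x == oone then f else jump x R
  end.
have [F FE] := bounded_rec id G.
have split_pow s p : ~ split_at (omega_pow s) p.
  case: p => r x [/= sE xs rs].
  by have := oadd_lt_omega_pow rs xs; rewrite -sE ltxx.
have F0 : F ozero = id.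
  rewrite FE /G; case: pselect => [e|_]; last by rewrite eqxx.
  by have [p [_]] := e; rewrite ltNge ozero_le.
have pow_neq0 s : (omega_pow s == ozero) = false.
  by apply/negbTE; rewrite gt_eqF // omega_pow_gt0.
have F1 : F oone = f.
  rewrite FE /G -omega_pow0; case: pselect => [e|_].
    by have [p /split_pow] := e.
  by rewrite pow_neq0 eqxx.
have Fpow s : ozero < s -> F (omega_pow s) = jump (omega_pow s) F.
  move=> s0; rewrite FE /G; case: pselect => [e|_].
    by have [p /split_pow] := e.
  rewrite pow_neq0 -omega_pow0.
  rewrite (inj_eq (inc_inj (normal_mono omega_pow_normal))) gt_eqF //.
  (* The guard of [bounded_rec] holds on the whole range of the supremum. *)
  have R u : sup_below (omega_pow s)
      ((fun y => if y < omega_pow s then F y else id)^~ u) =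
      sup_below (omega_pow s) (F^~ u).
    by congr osup; apply/seteqP; split=> x [z /= zs <-]; exists z; rewrite ?zs.
  by rewrite /jump R; congr ord_rec; apply/funext => v; rewrite R.
have FD r x : x < oadd (omega_pow r) x ->
    F (oadd (omega_pow r) x) = F (omega_pow r) \o F x.
  have [->|/eqP/olt0P x0] := eqVneq x ozero; first by rewrite oadd0 F0.
  move=> xr; rewrite FE /G; case: pselect => [e|]; last first.
    case; exists (r, x); split=> //=.
    by rewrite -{1}(oadd0 (omega_pow r)) lto_add2l.
  (* The chosen pair is [(r, x)]: the leading exponent is unique and addition cancels on the
     left. *)
  case: (cid e) => -[t y] /= [/= yE yx tx]; rewrite yx tx.
  have rt : r = t.
    by apply: le_anti; rewrite (leading_exponent_le yE) //
       (leading_exponent_le (esym yE)) // -yE.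
  by move: yE; rewrite -rt => /oaddI <-.
have base : hyp_base F by split=> //; rewrite F1.
have sF s : ozero < s -> sup_clauses F s.
  move=> s0; split=> [|x|l ll _]; rewrite (Fpow _ s0) /jump.
  - by rewrite ord_rec0.
  - by rewrite ord_recS.
  - by rewrite ord_rec_limit.
have gF : forall s, good F s.
  by apply: sup_clauses_good base _ => s s0 _; exact: sF.
have mono s y x x' :=
  below_mono (s := s) base (fun r _ => gF r) (x := x) (x' := x') y.
exists F; split=> [x||r x _|r r0|r x r0|r x r0 lx] //.
- by rewrite F0.
- exact: FD.
- by apply/(cvg_below _ (omega_pow_limit r0) (mono _ _)); case: (sF _ r0).
- by apply/(cvg_below _ (omega_pow_limit r0) (mono _ _)); case: (sF _ r0).
- apply/(cvg_below _ lx) => [y y' yy' _|]; last exact: (gF r).1.2.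
  by rewrite (normal_mono (gF r).1).
Qed.

Lemma hyperation_unique f F F' : hyperation f F -> hyperation f F' -> F = F'.
Proof.
move=> [wF minF] [wF' minF']; apply/funext => x; apply/funext => y.
by apply: le_anti; rewrite minF // minF'.
Qed.

Theorem theorem4p6 (f : On -> On) (hf : normal f) :
  (exists! F : On -> On -> On, hyperation f F) /\
  (forall F : On -> On -> On, hyperation f F -> hyperation_recursion f F) /\
  (forall F : On -> On -> On, hyperation_recursion f F -> hyperation f F).
Proof.
have [F recF] := exists_recursion hf.
have hypF := recursion_hyperation hf recF.
split; first by exists F; split=> // F'; exact: hyperation_unique hypF.
split=> F'; last exact: recursion_hyperation.
(* The constructed solution is a hyperation, so by uniqueness it is [F']. *)
by move=> hypF'; rewrite -(hyperation_unique hypF hypF').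
Qed.
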